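(* Let $X_1,\ldots,X_n$ be i.i.d. with CDF $F=\alpha F_s+(1-\alpha)F_b$, with $\alpha_0$, $d_n$, $\hat F_{s,n}^\gamma$, $\check F_{s,n}^\gamma$ as defined in the context, and let $0<\beta<1$. Let $H_n$ be the CDF of $\sqrt n\,d_n(\mathbb{F}_n,F)$ and let $$\hat\alpha_L=\inf\left\{\gamma\in(0,1]:\gamma\,d_n(\hat F_{s,n}^\gamma,\check F_{s,n}^\gamma)\le\frac{H_n^{-1}(1-\beta)}{\sqrt n}\right\}.$$ Then $$P(\alpha_0\ge\hat\alpha_L)\ge1-\beta.$$ Furthermore, if $\alpha_0=0$, then $P(\hat\alpha_L=0)=1-\beta$, i.e., $\hat\alpha_L$ is an exact lower bound.
   Context: Model: $\alpha\in[0,1]$, $F_s\neq F_b$ are CDFs on $\mathbb{R}$, $F=\alpha F_s+(1-\alpha)F_b$, and $\alpha_0:=\inf\{\gamma\in(0,1]:[F-(1-\gamma)F_b]/\gamma\text{ is a CDF}\}$. $\mathbb{F}_n$ is the empirical CDF of $X_1,\dots,X_n$. For functions $g,h$ on $\mathbb{R}$, $d_n^2(g,h)=\int(g-h)^2\,d\mathbb{F}_n$. For $\gamma\in(0,1]$, $\hat F_{s,n}^\gamma=[\mathbb{F}_n-(1-\gamma)F_b]/\gamma$, and $\check F_{s,n}^\gamma$ is a CDF minimising $W\mapsto d_n(W,\hat F_{s,n}^\gamma)$ over all CDFs $W$; equivalently, $(\check F_{s,n}^\gamma(X_{(i)}))_{i=1}^n$ is the Euclidean projection of $(\hat F_{s,n}^\gamma(X_{(i)}))_{i=1}^n$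 onto $\{\theta\in\mathbb{R}^n:0\le\theta_1\le\dots\le\theta_n\le1\}$, where $X_{(i)}$ are the order statistics. $H_n^{-1}$ denotes the quantile function of $H_n$.
   Formalization: The exactness claim fails for general F (e.g. F=F_b a point mass); for α_0=0 it is proved that P(α̂_L=0)=H_n(H_n^{-1}(1-β)) always, and that this equals 1-β when F is continuous. *)

(* Defs.v *)
From HB Require Import structures.
From mathcomp Require Import all_boot all_order all_algebra.
From mathcomp Require Import all_classical all_reals all_analysis.

Set Implicit Arguments.
Unset Strict Implicit.
Unset Printing Implicit Defensive.

Import Order.TTheory GRing.Theory Num.Theory.
Import numFieldNormedType.Exports.

Local Open Scope classical_set_scope.
Local Open Scope ring_scope.

Definition is_cdf (R : realType) (G : R -> R) : Prop :=
  [/\ {homo G : x y / x <= y}, right_continuous G,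
      G t @[t --> -oo] --> (0 : R) & G t @[t --> +oo] --> (1 : R)].

Definition mutually_independent (d : measure_display) (T : measurableType d)
    (R : realType) (P : probability T R) (n : nat)
    (X : 'I_n -> {RV P >-> R}) : Prop :=
  forall (J : {set 'I_n}) (A : 'I_n -> set R),
    (forall i, measurable (A i)) ->
    P (\bigcap_(i in [set` J]) (X i @^-1` A i))
    = (\prod_(i in J) P (X i @^-1` A i))%E.

Definition iid_cdf (d : measure_display) (T : measurableType d)
    (R : realType) (P : probability T R) (n : nat)
    (X : 'I_n -> {RV P >-> R}) (F : R -> R) : Prop :=
  mutually_independent X /\ forall i t, cdf (X i) t = (F t)%:E.

Definition mixture (R : realType) (alpha : R) (Fs Fb : R -> R) : R -> R :=
  fun t => alpha * Fs t + (1 - alpha) * Fb t.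

(* With G := F this is the candidate signal in the definition of alpha0; with
   G the empirical CDF it is the naive estimator of the signal, which in
   general is not a CDF. *)
Definition unmix (R : realType) (G Fb : R -> R) (gamma : R) : R -> R :=
  fun t => (G t - (1 - gamma) * Fb t) / gamma.

Definition alpha0 (R : realType) (F Fb : R -> R) : R :=
  inf [set gamma : R | 0 < gamma <= 1 /\ is_cdf (unmix F Fb gamma)].

Definition ecdf (R : realType) (n : nat) (x : 'I_n -> R) : R -> R :=
  fun t => n%:R^-1 * \sum_(i < n) (x i <= t)%R%:R.

(* The L2 distance for the empirical measure of the sample x: the integral
   against the empirical CDF is the average over the n sample points, repeated
   values being counted with multiplicity. *)
Definition dist_n (R : realType) (n : nat) (x : 'I_n -> R) (g h : R -> R) : R :=
  Num.sqrt (n%:R^-1 * \sum_(i < n) (g (x i) - h (x i)) ^+ 2).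

(* Only the values of W at the sample points are determined by this. *)
Definition is_closest_cdf (R : realType) (n : nat) (x : 'I_n -> R)
    (f W : R -> R) : Prop :=
  is_cdf W /\ forall V, is_cdf V -> dist_n x W f <= dist_n x V f.

Definition sample (d : measure_display) (T : measurableType d)
    (R : realType) (P : probability T R) (n : nat)
    (X : 'I_n -> {RV P >-> R}) (w : T) : 'I_n -> R :=
  fun i => X i w.

Definition Hn (d : measure_display) (T : measurableType d)
    (R : realType) (P : probability T R) (n : nat)
    (X : 'I_n -> {RV P >-> R}) (F : R -> R) : R -> R :=
  fun t => fine (P [set w | Num.sqrt n%:R
    * dist_n (sample X w) (ecdf (sample X w)) F <= t]).

(* H (quantile H u) >= u for a CDF H and 0 < u < 1, with equality exactly when
   H attains the value u; it may be strict when H has jumps. *)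
Definition quantile (R : realType) (H : R -> R) (u : R) : R :=
  inf [set t : R | u <= H t].

(* Fcheck gamma plays the role of the closest CDF to the naive estimator
   unmix (ecdf x) Fb gamma, and q that of the critical value. *)
Definition alphaL (R : realType) (n : nat) (x : 'I_n -> R) (Fb : R -> R)
    (Fcheck : R -> R -> R) (q : R) : R :=
  inf [set gamma : R | 0 < gamma <= 1 /\
    gamma * dist_n x (unmix (ecdf x) Fb gamma) (Fcheck gamma)
      <= q / Num.sqrt n%:R].

(* Main.v *)
Require Import Defs.
From HB Require Import structures.
From mathcomp Require Import all_boot all_order all_algebra.
From mathcomp Require Import all_classical all_reals all_analysis.
From mathcomp Require Import measurable_realfun ring lra.

Import Order.TTheory GRing.Theory Num.Theory.
Import numFieldNormedType.Exports.

Local Open Scope classical_set_scope.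
Local Open Scope ring_scope.

(* Writing mixture g V Fb = g V + (1 - g) Fb, the criterion of alphaL at g equals
   g d_n(unmix Fn Fb g, Fcheck g) = min_V d_n(Fn, mixture g V Fb) over CDFs V.
   The weights g where it is at most c = q / sqrt n are upward closed and contain
   1, and they contain every g for which unmix F Fb g is a CDF as soon as
   d_n(Fn, F) <= c; hence {d_n(Fn, F) <= c} is included in {alphaL <= alpha0},
   and P(d_n(Fn, F) <= c) = Hn q >= 1 - beta by right continuity of Hn. When
   alpha0 = 0 one has F = Fb, and since the criterion is within g of d_n(Fn, Fb),
   alphaL = 0 exactly when d_n(Fn, F) <= c. For continuous F the statistic has no
   atom, so Hn q = 1 - beta. Since P is only constrained on measurable sets, the
   event {alphaL <= alpha0} must also be shown measurable: the minimum over V can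
   be replaced by minima over finitely many step functions with jumps at sample
   points, up to an error 1/m. *)

(** * Distribution functions, mixtures and the empirical distance *)

Section Cdf.
Context {R : realType}.
Implicit Types (F G V W : R -> R) (t : R).

Lemma is_cdf_ge0 F t : is_cdf F -> 0 <= F t.
Proof.
case=> homF _ F0 _; apply: (cvgr_to_le F0).
by near=> u; apply: homF; near: u; exact: nbhs_ninfty_le (num_real t).
Unshelve. all: by end_near. Qed.

Lemma is_cdf_le1 F t : is_cdf F -> F t <= 1.
Proof.
case=> homF _ _ F1; apply: (cvgr_to_ge F1).
by near=> u; apply: homF; near: u; exact: nbhs_pinfty_ge (num_real t).
Unshelve. all: by end_near. Qed.

Lemma cdf_dist_le1 G V t : is_cdf G -> is_cdf V -> `|G t - V t| <= 1.
Proof.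
move=> cG cV; rewrite ler_norml; have := is_cdf_ge0 _ t cG; have := is_cdf_le1 _ t cG.
by have := is_cdf_ge0 _ t cV; have := is_cdf_le1 _ t cV; move=> *; apply/andP; split; lra.
Qed.

Lemma mixture_is_cdf (a : R) F G :
  0 <= a <= 1 -> is_cdf F -> is_cdf G -> is_cdf (mixture a F G).
Proof.
move=> /andP[a0 a1] [hF cF F0 F1] [hG cG G0 G1]; split.
- by move=> x y xy; rewrite lerD// ler_wpM2l ?subr_ge0 ?hF ?hG.
- by move=> x; apply: cvgD; (apply: cvgM; first exact: cvg_cst); [exact: cF|exact: cG].
- rewrite (_ : 0 = a * 0 + (1 - a) * 0); last by ring.
  by apply: cvgD; (apply: cvgM; first exact: cvg_cst).
- rewrite [X in _ --> X](_ : _ = a * 1 + (1 - a) * 1); last by ring.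
  by apply: cvgD; (apply: cvgM; first exact: cvg_cst).
Qed.

Lemma ecdf_is_cdf (m : nat) (x : 'I_m -> R) : (0 < m)%N -> is_cdf (ecdf x).
Proof.
move=> m0; have mE : m%:R^-1 * (\sum_(i < m) 1) = 1 :> R.
  by rewrite sumr_const card_ord mulVf// pnatr_eq0 -lt0n.
split.
- move=> s t st; rewrite /ecdf ler_wpM2l ?invr_ge0//; apply: ler_sum => i _.
  by rewrite ler_nat leq_b1 || (case: (leP (x i) s) => // /le_trans ->).
- move=> t; apply: cvgM; first exact: cvg_cst.
  apply: (cvg_big add_continuous) => i _; apply: cvg_near_cst.
  have [xt|tx] := leP (x i) t.
    by near=> s; rewrite (le_trans xt).
  by near=> s; rewrite leNgt (_ : s < x i)//.
- apply: cvg_near_cst; near=> s; rewrite /ecdf big1 ?mulr0// => i _.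
  rewrite leNgt (_ : s < x i)//; move: i.
  near: s; apply: filter_forall => i; exact: nbhs_ninfty_lt (num_real _).
- rewrite -[X in _ --> X]mE; apply: cvg_near_cst; near=> s.
  congr (_ * _); apply: eq_bigr => i _; rewrite (_ : x i <= s)//; move: i.
  near: s; apply: filter_forall => i; exact: nbhs_pinfty_ge (num_real _).
Unshelve. all: by end_near. Qed.

Lemma unmix1 F Fb : unmix F Fb 1 = F.
Proof. by apply/funext => t; rewrite /unmix subrr mul0r subr0 divr1. Qed.

Lemma alpha0_ge0 F Fb : is_cdf F -> 0 <= alpha0 F Fb.
Proof.
move=> cdfF; apply: lb_le_inf => [|g [/andP[/ltW]]//].
by exists 1; rewrite /= ltr01 lexx unmix1.
Qed.

Lemma dist_nC {n} (x : 'I_n -> R) (g h : R -> R) : dist_n x g h = dist_n x h g.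
Proof.
by congr (Num.sqrt (_ * _)); apply: eq_bigr => i _; rewrite -opprB sqrrN.
Qed.

Lemma dist_n_le {n} (x : 'I_n -> R) (g h : R -> R) (c : R) : (0 < n)%N -> 0 <= c ->
  (dist_n x g h <= c) = (\sum_(i < n) (g (x i) - h (x i)) ^+ 2 <= n%:R * c ^+ 2).
Proof.
move=> n0 c0; have n0' : 0 < n%:R :> R by rewrite ltr0n.
rewrite -{1}(ger0_norm c0) -sqrtr_sqr ler_sqrt ?sqr_ge0//.
by rewrite ler_pdivrMl.
Qed.

(** Pointwise, [g * (unmix G Fb g - V) = G - mixture g V Fb]. This removes the division by [g] from
    the criterion. *)
Lemma scaled_dist_unmix {n} (x : 'I_n -> R) (G Fb V : R -> R) (g : R) : 0 < g ->
  g * dist_n x (unmix G Fb g) V = dist_n x G (mixture g V Fb).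
Proof.
move=> g0; rewrite -{1}(ger0_norm (ltW g0)) -sqrtr_sqr -sqrtrM ?sqr_ge0//.
rewrite mulrCA mulr_sumr; congr (Num.sqrt (_ * _)); apply: eq_bigr => i _.
by rewrite /unmix /mixture; field; rewrite gt_eqF.
Qed.

(** Scaling by [g > 0] preserves minimality, so the closest CDF also gives the mixture of weight [g]
    closest to [G]. *)
Lemma closest_cdf_le {n} (x : 'I_n -> R) (G Fb W V : R -> R) (g : R) : 0 < g ->
  is_closest_cdf x (unmix G Fb g) W -> is_cdf V ->
  dist_n x G (mixture g W Fb) <= dist_n x G (mixture g V Fb).
Proof.
move=> g0 [_ minW] cdfV; rewrite -!scaled_dist_unmix// ler_wpM2l ?(ltW g0)//.
by rewrite ![dist_n x (unmix _ _ _) _]dist_nC minW.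
Qed.

(** This is the set whose infimum is [alphaL], rewritten through [scaled_dist_unmix], with [c] for
    [q / Num.sqrt n%:R]. *)
Definition admissible {n} (x : 'I_n -> R) (Fb : R -> R) (Fc : R -> R -> R) (c : R) : set R :=
  [set g | 0 < g <= 1 /\ dist_n x (ecdf x) (mixture g (Fc g) Fb) <= c].

(* The value None stands for a point to the right of the whole sample. *)
Definition points {n m} (x : 'I_n -> R) (s : {ffun 'I_m -> option 'I_n}) : 'I_m -> R :=
  fun l => if s l is Some j then x j else 1 + \sum_(i < n) `|x i|.

(** Rounding [V] down to multiples of [1/m] gives a step function whose [m] jumps can be placed at
    sample points. For fixed [m] only finitely many choices of [s] exist, which later makes the
    minimum over CDFs measurable. *)
Lemma cdf_approx {n m} (x : 'I_n -> R) V : (0 < m)%N -> is_cdf V ->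
  exists s : {ffun 'I_m -> option 'I_n},
    forall i, `|ecdf (points x s) (x i) - V (x i)| <= m%:R^-1.
Proof.
move=> m0 cdfV; have m0' : 0 < m%:R :> R by rewrite ltr0n.
(* The jump number [l] sits at the leftmost sample point where [V] has reached [(l + 1) / m], or
   beyond the sample if there is none. *)
pose S (l : 'I_m) := [pred j | l.+1%:R <= m%:R * V (x j)].
exists [ffun l => if [pick j in S l] is Some j0
                  then Some [arg min_(j < j0 | j \in S l) x j]%O else None] => i.
set s := finfun _.
have sP (l : 'I_m) : (points x s l <= x i) = (l.+1%:R <= m%:R * V (x i)).
  rewrite /points ffunE; case: pickP => [j0 Sj0|S0].
    case: arg_minP => // j Sj minj; apply/idP/idP => [ji|Si]; last exact: minj.
    apply: le_trans Sj _; rewrite ler_pM2l//; by case: cdfV => homV _ _ _; exact: homV.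
  have -> : (1 + \sum_j `|x j| <= x i) = false.
    apply/negbTE; rewrite -ltNge (le_lt_trans (ler_norm _))// (bigD1 i)//=.
    by rewrite addrCA ltrDl ltr_wpDr ?sumr_ge0.
  by apply/esym; have := S0 i; rewrite !inE.
have V0 := is_cdf_ge0 _ (x i) cdfV; have V1 := is_cdf_le1 _ (x i) cdfV.
have mV0 : 0 <= m%:R * V (x i) by rewrite mulr_ge0// ltW.
(* By [sP], exactly the jumps [l < k] lie at or before [x i]. *)
pose k := Num.truncn (m%:R * V (x i)).
have km : (k <= m)%N.
  by rewrite -(ler_nat R) (le_trans (_ : _ <= m%:R * V (x i))) ?truncn_le// ger_pMr.
have -> : ecdf (points x s) (x i) = k%:R / m%:R.
  rewrite /ecdf mulrC; congr (_ / _); under eq_bigr => l _ do rewrite sP -truncn_ge_nat//.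
  rewrite -natr_sum; congr _%:R.
  rewrite -(big_mkord xpredT (fun l => (l < k)%N : nat)) (big_cat_nat _ km)//=.
  rewrite [X in (X + _)%N](eq_big_nat _ _ (F2 := fun=> 1%N)).
    rewrite sum_nat_const_nat subn0 muln1 big_nat_cond big1 ?addn0// => l.
    by rewrite andbT leqNgt => /andP[/negbTE ->].
  by move=> l /andP[_ ->].
have -> : k%:R / m%:R - V (x i) = (k%:R - m%:R * V (x i)) * m%:R^-1.
  by field; rewrite gt_eqF.
rewrite normrM [X in _ * X]ger0_norm ?invr_ge0// ler_piMl ?invr_ge0//.
have /andP[kl ku] := truncn_itv mV0; rewrite -/k -addn1 natrD in kl ku.
by rewrite ler_norml; apply/andP; split; lra.
Qed.

(** * The set of admissible weights and its infimum *)

Section Admissible.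
Context {n : nat} (x : 'I_n -> R) (Fb : R -> R) (Fc : R -> R -> R) (c : R).
Hypothesis n0 : (0 < n)%N.
Hypothesis cdfFb : is_cdf Fb.
Hypothesis closest : forall g, 0 < g <= 1 ->
  is_closest_cdf x (unmix (ecdf x) Fb g) (Fc g).
Hypothesis c0 : 0 <= c.

Let A := admissible x Fb Fc c.

Lemma alphaLE q : c = q / Num.sqrt n%:R -> alphaL x Fb Fc q = inf A.
Proof.
move=> cE; congr inf; apply/seteqP; split => g /= [/andP[g0 g1]].
  by rewrite scaled_dist_unmix// -cE => ?; split; rewrite ?g0.
by rewrite -scaled_dist_unmix// cE => ?; split; rewrite ?g0.
Qed.

Lemma admissible_cdf g V : 0 < g <= 1 -> is_cdf V ->
  dist_n x (ecdf x) (mixture g V Fb) <= c -> A g.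
Proof.
move=> g01 cdfV Vc; split => //; apply: le_trans Vc.
by case/andP: (g01) => g0 _; apply: closest_cdf_le => //; exact: closest.
Qed.

Lemma admissible1 : A 1.
Proof.
apply: (@admissible_cdf _ (ecdf x)); rewrite ?ltr01 ?lexx//; first exact: ecdf_is_cdf.
rewrite dist_n_le// big1 ?mulr_ge0 ?sqr_ge0// => i _.
by rewrite /mixture subrr mul0r addr0 mul1r subrr expr0n.
Qed.

(** A mixture of weight [g] is also one of weight [h]: part of [Fb] is moved into the signal, which
    becomes [mixture (g / h) (Fc g) Fb]. *)
Lemma admissible_up g h : A g -> g <= h <= 1 -> A h.
Proof.
move=> [/andP[g0 g1] Ag] /andP[gh h1]; have h0 := lt_le_trans g0 gh.
apply: (@admissible_cdf _ (mixture (g / h) (Fc g) Fb)); first by rewrite h0.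
  apply: mixture_is_cdf => //; first by rewrite divr_ge0 ?(ltW g0) ?(ltW h0)// ler_pdivrMr// mul1r.
  by have [] := @closest g _; rewrite ?g0.
rewrite (_ : mixture h _ _ = mixture g (Fc g) Fb)//.
by apply/funext => t; rewrite /mixture; field; rewrite gt_eqF.
Qed.

Lemma inf_admissible_ge0 : 0 <= inf A.
Proof. by apply: lb_le_inf; [exists 1; exact: admissible1|move=> g [/andP[/ltW]]]. Qed.

(** Upward closure allows the infimum to be tested on a sequence of weights decreasing to [a],
    capped at 1. The condition is thereby countable, as measurability demands. *)
Lemma inf_admissible_le a : 0 <= a ->
  (inf A <= a) <-> forall k, A (Num.min 1 (a + k.+1%:R^-1)).
Proof.
have lbA : has_lbound A by exists 0 => g [/andP[/ltW]].
move=> a0; split => [Aa k|Ak].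
  have k0 : 0 < k.+1%:R^-1 :> R by rewrite invr_gt0.
  have [g Ag ga] : exists2 g, A g & g < a + k.+1%:R^-1.
    by apply: inf_lt; [exists 1; exact: admissible1|by rewrite (le_lt_trans Aa)// ltrDl].
  have [/andP[_ g1] _] := Ag; apply: (admissible_up _ _ Ag).
  by rewrite le_min g1 (ltW ga) ge_min lexx.
apply/ler_addgt0Pr => e e0; have [k ke] : exists k : nat, k.+1%:R^-1 <= e.
  exists (Num.truncn e^-1); rewrite -[leRHS]invrK lef_pV2 ?posrE ?invr_gt0//.
  by rewrite ltW// truncnS_gt.
apply: le_trans (ge_inf lbA (Ak k)) _.
by rewrite ge_min lerD2l ke orbT.
Qed.

(** The increment is at most [2 |a| e + e ^+ 2], hence the constant 3. *)
Lemma sqr_perturb (a b e : R) : `|a| <= 1 -> `|b - a| <= e -> e <= 1 ->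
  b ^+ 2 <= a ^+ 2 + 3 * e.
Proof. by rewrite !ler_norml => /andP[? ?] /andP[? ?] ?; nra. Qed.

Lemma sum_sqr_perturb (a b : 'I_n -> R) (e : R) :
  (forall i, `|a i| <= 1) -> (forall i, `|b i - a i| <= e) -> e <= 1 ->
  \sum_(i < n) b i ^+ 2 <= \sum_(i < n) a i ^+ 2 + n%:R * (3 * e).
Proof.
move=> a1 bae e1; rewrite mulr_natl -[X in _ *+ X]card_ord -sumr_const -big_split/=.
by apply: ler_sum => i _; exact: sqr_perturb.
Qed.

Lemma le_of_archi (X : R) :
  (forall k, X <= n%:R * (c ^+ 2 + 3 * k.+1%:R^-1)) -> X <= n%:R * c ^+ 2.
Proof.
have n0' : 0 < n%:R :> R by rewrite ltr0n.
move=> Xk; apply/ler_addgt0Pr => e e0.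
pose k := Num.truncn (n%:R * 3 / e); apply: le_trans (Xk k) _.
rewrite mulrDr lerD2l mulrA ler_pdivrMr ?ltr0n// -ler_pdivrMl//.
by rewrite mulrC ltW// truncnS_gt.
Qed.

(** A mixture of weight [g] is uniformly within [g] of [Fb]; admissibility of all the weights
    [k.+1%:R^-1] thus gives the bound in the limit. Conversely, [V = Fb] turns every mixture into
    [Fb] and makes every weight admissible. *)
Lemma inf_admissible_eq0 : inf A = 0 <-> dist_n x (ecdf x) Fb <= c.
Proof.
rewrite dist_n_le//; split => [A0|Fbc].
  have {A0} /inf_admissible_le : inf A <= 0 by rewrite A0.
  move=> /(_ (lexx _)) Ak; apply: le_of_archi => k; have := Ak k.
  have k01 : 0 < (k.+1%:R^-1 : R) <= 1 by rewrite invr_gt0 ltr0n invf_le1// ler1n.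
  have /andP[k0 k1] := k01.
  rewrite add0r (min_idPr _)// => -[_]; rewrite dist_n_le// => Wc.
  have [cdfW _] := closest _ k01.
  rewrite mulrDr; apply: le_trans (lerD Wc (lexx _)).
  apply: sum_sqr_perturb => // i.
    by apply: cdf_dist_le1; [exact: ecdf_is_cdf|apply: mixture_is_cdf => //; rewrite ltW].
  rewrite (_ : _ - _ = k.+1%:R^-1 * (Fc k.+1%:R^-1 (x i) - Fb (x i))); last first.
    by rewrite /mixture; ring.
  by rewrite normrM gtr0_norm// ger_pMr// cdf_dist_le1.
apply/eqP; rewrite eq_le inf_admissible_ge0 andbT; apply/inf_admissible_le => // k.
apply: (admissible_cdf _ Fb) => //; first by rewrite add0r lt_min ltr01 invr_gt0 ltr0n ge_min lexx.
rewrite (_ : mixture _ Fb Fb = Fb) ?dist_n_le//.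
by apply/funext => t; rewrite /mixture; ring.
Qed.

(** If [unmix F Fb g] is a CDF, taking it as the signal reproduces [F] exactly, so [g] is
    admissible. *)
Lemma inf_admissible_le_alpha0 F : is_cdf F -> dist_n x (ecdf x) F <= c ->
  inf A <= alpha0 F Fb.
Proof.
move=> cdfF Fc'; apply: lb_le_inf.
  by exists 1; rewrite /= ltr01 lexx unmix1.
move=> g [g01 cdfg]; apply: ge_inf; first by exists 0 => h [/andP[/ltW]].
apply: (admissible_cdf _ _ g01 cdfg).
rewrite (_ : mixture _ _ _ = F)//; apply/funext => t.
by rewrite /mixture /unmix; field; case/andP: g01 => ? _; rewrite gt_eqF.
Qed.

(** This eliminates [Fc], whose dependence on the outcome is not known to be measurable. Forwards,
    [Fc g] is approximated by [cdf_approx]; backwards, each step function is a CDF and competes with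
    [Fc g], and the error vanishes as [k] grows. *)
Lemma admissibleP g : 0 < g <= 1 ->
  A g <-> forall k, exists s : {ffun 'I_k.+1 -> option 'I_n},
    \sum_(i < n) (ecdf x (x i) - mixture g (ecdf (points x s)) Fb (x i)) ^+ 2
      <= n%:R * (c ^+ 2 + 3 * k.+1%:R^-1).
Proof.
move=> g01; have /andP[g0 g1] := g01; have [cdfW _] := closest _ g01.
split => [[_] + k|As].
  rewrite dist_n_le// => Wc; have [s sW] := @cdf_approx _ k.+1 x _ isT cdfW.
  exists s; rewrite mulrDr; apply: le_trans (lerD Wc (lexx _)).
  apply: sum_sqr_perturb => [i|i|]; last by rewrite invf_le1// ler1n.
    by apply: cdf_dist_le1; [exact: ecdf_is_cdf|apply: mixture_is_cdf => //; rewrite ltW].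
  rewrite (_ : _ - _ = g * - (ecdf (points x s) (x i) - Fc g (x i))); last first.
    by rewrite /mixture; ring.
  by rewrite normrM normrN gtr0_norm// (le_trans _ (sW i))// ler_piMl.
split => //; rewrite dist_n_le//; apply: le_of_archi => k.
have [s] := As k; apply: le_trans.
have cdfs := ecdf_is_cdf k.+1 (points x s) isT.
have := @closest_cdf_le _ x (ecdf x) Fb _ _ _ g0 (closest _ g01) cdfs.
rewrite /dist_n ler_sqrt ?ler_pM2l ?invr_gt0 ?ltr0n//.
by rewrite mulr_ge0 ?invr_ge0// sumr_ge0// => i _; exact: sqr_ge0.
Qed.

End Admissible.

(** [F - Fb] is [g] times a difference of two CDFs, for arbitrarily small [g]. *)
Lemma alpha0_eq0 F Fb : is_cdf F -> is_cdf Fb -> alpha0 F Fb = 0 -> F = Fb.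
Proof.
move=> cdfF cdfFb a0; apply/funext => t; apply/eqP; rewrite -subr_eq0 -normr_le0.
apply/ler_addgt0Pr => e e0; rewrite add0r.
have [g [/andP[g0 g1] cdfg] ge] :
    exists2 g, 0 < g <= 1 /\ is_cdf (unmix F Fb g) & g < e.
  apply: inf_lt; last by rewrite -/(alpha0 F Fb) a0.
  by exists 1; rewrite /= ltr01 lexx unmix1.
rewrite (_ : F t - Fb t = g * (unmix F Fb g t - Fb t)); last first.
  by rewrite /unmix; field; rewrite gt_eqF.
rewrite normrM gtr0_norm// (le_trans _ (ltW ge))// ger_pMr// ler_norml.
have := is_cdf_ge0 _ t cdfg; have := is_cdf_le1 _ t cdfg.
by have := is_cdf_ge0 _ t cdfFb; have := is_cdf_le1 _ t cdfFb; move=> *; apply/andP; split; lra.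
Qed.

End Cdf.

(** * Measurability of the events about the infimum *)

Section Measurability.
Context {d : measure_display} {T : measurableType d} {R : realType}.

Lemma measurable_ecdf {m} (p : 'I_m -> T -> R) (y : T -> R) :
  (forall l, measurable_fun setT (p l)) -> measurable_fun setT y ->
  measurable_fun setT (fun w => ecdf (p^~ w) (y w)).
Proof.
move=> mp my; apply: measurable_funM; first exact: measurable_cst.
apply: measurable_sum => l.
rewrite (_ : (fun _ => _) = (fun w => if p l w <= y w then 1 else 0 : R)).
  by apply: measurable_fun_ifT => //; exact: measurable_fun_ler.
by apply/funext => w; case: ifP.
Qed.

Lemma measurable_points {n m} (X : 'I_n -> T -> R) (s : {ffun 'I_m -> option 'I_n}) l :
  (forall i, measurable_fun setT (X i)) ->
  measurable_fun setT (fun w => points (X^~ w) s l).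
Proof.
move=> mX; rewrite /points; case: (s l) => [j|]; first exact: mX.
apply: measurable_funD; first exact: measurable_cst.
by apply: measurable_sum => i; apply: measurableT_comp.
Qed.

Lemma is_cdf_measurable (F : R -> R) : is_cdf F -> measurable_fun setT F.
Proof. by case=> homF _ _ _; apply: nondecreasing_measurable. Qed.

(** By [admissibleP] the event is a countable intersection of finite unions of sublevel sets of
    measurable functions. *)
Lemma measurable_admissible {n} (X : 'I_n -> T -> R) (Fb : R -> R)
    (Fc : T -> R -> R -> R) (c g : R) :
  (0 < n)%N -> is_cdf Fb -> 0 <= c -> 0 < g <= 1 ->
  (forall i, measurable_fun setT (X i)) ->
  (forall w g, 0 < g <= 1 -> is_closest_cdf (X^~ w) (unmix (ecdf (X^~ w)) Fb g) (Fc w g)) ->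
  measurable [set w | admissible (X^~ w) Fb (Fc w) c g].
Proof.
move=> n0 cdfFb c0 g01 mX closest.
pose Q k (s : {ffun 'I_k.+1 -> option 'I_n}) w :=
  \sum_(i < n) (ecdf (X^~ w) (X i w) -
    mixture g (ecdf (points (X^~ w) s)) Fb (X i w)) ^+ 2.
rewrite (_ : [set _ | _] = \bigcap_k \bigcup_(s in [set: {ffun 'I_k.+1 -> option 'I_n}])
    [set w | Q k s w <= n%:R * (c ^+ 2 + 3 * k.+1%:R^-1)]); last first.
  apply/seteqP; split => w /=.
    move=> /admissibleP Aw k _; have [//|||||s sQ] := Aw _ _ _ _ _ k => //.
      exact: closest.
    by exists s.
  move=> Qw; apply/admissibleP => //; first exact: closest.
  by move=> k; have [s _ sQ] := Qw k I; exists s.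
apply: bigcap_measurable => // k _; apply: fin_bigcup_measurable => // s _.
rewrite -[X in measurable X]setTI; apply: measurable_fun_le => //.
apply: measurable_sum => i; apply: measurable_funX; apply: measurable_funB.
  exact: measurable_ecdf.
apply: measurable_funD; apply: measurable_funM; try exact: measurable_cst.
  apply: (@measurable_ecdf k.+1 (fun l w => points (X^~ w) s l)) => // l.
  exact: measurable_points.
by apply: measurableT_comp => //; exact: is_cdf_measurable.
Qed.

Lemma measurable_inf_admissible {n} (X : 'I_n -> T -> R) (Fb : R -> R)
    (Fc : T -> R -> R -> R) (c a : R) :
  (0 < n)%N -> is_cdf Fb -> 0 <= c -> 0 <= a ->
  (forall i, measurable_fun setT (X i)) ->
  (forall w g, 0 < g <= 1 -> is_closest_cdf (X^~ w) (unmix (ecdf (X^~ w)) Fb g) (Fc w g)) ->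
  measurable [set w | inf (admissible (X^~ w) Fb (Fc w) c) <= a].
Proof.
move=> n0 cdfFb c0 a0 mX closest.
rewrite (_ : [set _ | _] = \bigcap_k [set w |
    admissible (X^~ w) Fb (Fc w) c (Num.min 1 (a + k.+1%:R^-1))]).
  apply: bigcap_measurable => // k _; apply: measurable_admissible => //.
  by rewrite lt_min ltr01 ge_min lexx ltr_wpDl// invr_gt0.
apply/seteqP; split => w /=.
  by move/inf_admissible_le => Aw k _; apply: Aw => //; exact: closest.
by move=> Aw; apply/inf_admissible_le => // [|k]; [exact: closest|exact: Aw].
Qed.

End Measurability.

(** * Probability estimates *)

Section Probability.
Context {d : measure_display} {T : measurableType d} {R : realType}.
Variable P : probability T R.

(** It serves for coverings by grid boxes and, with [e = 0], for finite unions of null sets. *)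
Lemma union_bound {I : finType} (A : I -> set T) (E : set T) (e : R) :
  measurable E -> (forall i, measurable (A i)) -> E `<=` \bigcup_i A i ->
  (forall i, P (A i) <= e%:E)%E -> (P E <= (#|I|%:R * e)%:E)%E.
Proof.
move=> mE mA EA Ae.
have sub (s : seq I) : (P (\big[setU/set0]_(i <- s) A i) <= ((size s)%:R * e)%:E)%E.
  elim: s => [|i s IHs]; first by rewrite big_nil measure0 mul0r.
  rewrite big_cons (le_trans (measureU2 _ _ _))//; first exact: bigsetU_measurable.
  by rewrite /= -addn1 natrD mulrDl mul1r addrC EFinD leeD.
apply: le_trans (le_trans (sub (enum I)) _); last by rewrite -cardE.
rewrite le_measure ?inE//; first exact: bigsetU_measurable.
rewrite -bigcup_seq => w /EA[i _ Aiw]; exists i => //=.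
by rewrite mem_enum.
Qed.

(** * The probability integral transform for a continuous CDF *)

Section ContinuousCdf.
Variable F : R -> R.
Hypotheses (cdfF : is_cdf F) (contF : continuous F).

(** Intermediate values; the levels 0 and 1 are limits that may not be attained. *)
Lemma cdf_level v : 0 < v < 1 -> exists x, F x = v.
Proof.
move=> /andP[v0 v1]; have [homF _ F0 F1] := cdfF.
have [a Fa] : exists a, F a <= v.
  have : \forall a \near -oo, F a <= v by exact: (cvgr_le _ F0).
  by move/(@filter_ex _ _ _).
have [b Fb] : exists b, v <= F b.
  have : \forall b \near +oo, v <= F b by exact: (cvgr_ge _ F1).
  by move/(@filter_ex _ _ _).
have Fab : F (Num.min a b) <= v by rewrite (le_trans _ Fa)// homF// ge_min lexx.
have mb : Num.min a b <= b by rewrite ge_min lexx orbT.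
have [|x _ <-] := IVT mb (v := v) (continuous_subspaceT contF); last by exists x.
by rewrite ge_min Fab le_max Fb orbT.
Qed.

Variable Y : {RV P >-> R}.
Hypothesis cdfY : forall t, cdf Y t = (F t)%:E.

Lemma cdfE t : P [set w | Y w <= t] = (F t)%:E.
Proof. by rewrite -cdfY /cdf /distribution /pushforward preimage_itvNyc. Qed.

Let mFY : measurable_fun setT (F \o Y).
Proof. by apply: measurableT_comp => //; exact: is_cdf_measurable. Qed.

Let mle u : measurable [set w | Y w <= u].
Proof. by rewrite -[X in measurable X]setTI; apply: measurable_fun_le. Qed.

Let mFle u : measurable [set w | F (Y w) <= u].
Proof. by rewrite -[X in measurable X]setTI; apply: (measurable_fun_le (f := F \o Y)). Qed.

Let mFlt u : measurable [set w | F (Y w) < u].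
Proof.
rewrite (_ : [set _ | _] = ~` [set w | u <= F (Y w)]).
  apply: measurableC; rewrite -[X in measurable X]setTI.
  exact: (measurable_fun_le (g := F \o Y)).
by apply/seteqP; split => w /=; rewrite ltNge => /negP.
Qed.

Let homF : {homo F : x y / x <= y}. Proof. by case: cdfF. Qed.

(** If [F x = b + e], then [F (Y w) <= b] forces [Y w <= x], an event of probability [b + e]. *)
Lemma probability_cdf_le b : 0 <= b -> (P [set w | (F (Y w) <= b)%R] <= b%:E)%E.
Proof.
move=> b0; apply/lee_addgt0Pr => e e0; rewrite -EFinD.
have [be1|be1] := leP 1 (b + e).
  by rewrite (le_trans (probability_le1 _ _))// lee_fin.
have [x xbe] : exists x, F x = b + e by apply: cdf_level; rewrite be1 ltr_wpDl.
rewrite -xbe -cdfE le_measure ?inE// => w /= Fb; rewrite leNgt; apply/negP => /ltW /homF.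
by rewrite xbe => /le_trans/(_ Fb); rewrite gerDl leNgt e0.
Qed.

Lemma probability_cdf_lt a : a <= 1 -> (a%:E <= P [set w | (F (Y w) < a)%R])%E.
Proof.
move=> a1; apply/lee_addgt0Pr => e e0.
have [ae0|ae0] := leP (a - e) 0.
  by rewrite (@le_trans _ _ e%:E) ?leeDr// lee_fin -subr_le0.
have [x xae] : exists x, F x = a - e by apply: cdf_level; rewrite ae0 ltrBlDr ltr_pwDr.
rewrite -leeBlDr// -EFinB -xae -cdfE le_measure ?inE// => w /= /homF.
by rewrite xae => /le_lt_trans; apply; rewrite gtrBl.
Qed.

Lemma probability_cdf_itv a b : a <= b ->
  (P [set w | (a <= F (Y w) <= b)%R] <= (b - a)%:E)%E.
Proof.
move=> ab.
(* Intervals missing [[0, 1]] are set apart, since the one-sided bounds require [0 <= b] and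
   [a <= 1]. *)
have empty : (b < 0) || (1 < a) -> (P [set w | (a <= F (Y w) <= b)%R] <= (b - a)%:E)%E.
  move=> ba; rewrite (_ : [set _ | _] = set0) ?measure0 ?lee_fin ?subr_ge0//.
  rewrite -subset0 => w /= /andP[aF Fb]; have := is_cdf_ge0 _ (Y w) cdfF.
  by have := is_cdf_le1 _ (Y w) cdfF; case/orP: ba; lra.
have [b0|b0] := ltP b 0; first by apply: empty; rewrite b0.
have [a1|a1] := ltP 1 a; first by apply: empty; rewrite a1 orbT.
rewrite (_ : [set _ | _] = [set w | F (Y w) <= b] `\` [set w | F (Y w) < a]); last first.
  apply/seteqP; split => w /=; first by case/andP => aF ->; split => //; apply/negP; rewrite -leNgt.
  by move=> [->] /negP; rewrite -leNgt => ->.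
rewrite measureD//; last by rewrite (le_lt_trans (probability_le1 _ _))// ltry.
rewrite setIidr => [|w /= /ltW /le_trans]; last exact.
rewrite EFinB leeB//; [exact: probability_cdf_le|exact: probability_cdf_lt].
Qed.

(** For nonnegative [u] and [v], [|u ^+ 2 - v ^+ 2| <= h ^+ 2] implies [|u - v| <= h]. The event
    thus confines [F (Y w)] to two intervals of length [2 * h]. *)
Lemma probability_sqr_near (c s h : R) : 0 < h ->
  (P [set w | (`|(c - F (Y w)) ^+ 2 - s| <= h ^+ 2 / 2)%R] <= (4 * h)%:E)%E.
Proof.
move=> h0; set E := [set w | _].
have mE : measurable E.
  rewrite -[X in measurable X]setTI; apply: measurable_fun_le => //.
  apply: measurableT_comp => //; apply: measurable_funB => //.
  by apply: measurable_funX; apply: measurable_funB.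
(* As [s] may be negative, the intervals are centred using a point of the event rather than a square
   root of [s]. *)
have [->|/set0P[w0 Ew0]] := eqVneq E set0.
  by rewrite measure0 lee_fin mulr_ge0// ltW.
pose v := `|c - F (Y w0)|.
pose I b := [set w | c + b - h <= F (Y w) <= c + b + h].
have mI b : measurable (I b).
  rewrite (_ : I b = [set w | F (Y w) <= c + b + h] `\` [set w | F (Y w) < c + b - h]).
    exact: measurableD.
  apply/seteqP; split => w; rewrite /I/=.
    by case/andP => aF ->; split => //; apply/negP; rewrite -leNgt.
  by move=> [->] /negP; rewrite -leNgt => ->.
have PI b : (P (I b) <= (2 * h)%:E)%E.
  rewrite (le_trans (probability_cdf_itv _ _ _))//; last by rewrite lee_fin; lra.
  by lra.
have EI : E `<=` I v `|` I (- v).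
  move=> w Ew; have {}Ew0 : `|v ^+ 2 - s| <= h ^+ 2 / 2 by rewrite /v real_normK ?num_real.
  rewrite /E/= -[(_ - _) ^+ 2]real_normK ?num_real// in Ew.
  have vw : `| `|c - F (Y w)| - v| <= h.
    have v0 : 0 <= v by exact: normr_ge0.
    have u0 := normr_ge0 (c - F (Y w)).
    move: Ew Ew0; rewrite !ler_norml => /andP[? ?] /andP[? ?].
    by apply/andP; split; nra.
  rewrite /I/=; case: (lerP 0 (c - F (Y w))) => cF; [right|left]; move: vw.
    by rewrite (ger0_norm cF) ler_norml => /andP[? ?]; apply/andP; split; lra.
  by rewrite (ltr0_norm cF) ler_norml => /andP[? ?]; apply/andP; split; lra.
apply: (@le_trans _ _ (P (I v) + P (I (- v)%R))%E).
  rewrite (le_trans _ (measureU2 _ _ _))// le_measure ?inE//; exact: measurableU.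
by rewrite (_ : 4 * h = 2 * h + 2 * h) ?EFinD ?leeD//; ring.
Qed.

End ContinuousCdf.

(** * Absence of atoms for sums of squares *)

Lemma measurable_cdf_itv F (a b : R) : is_cdf F -> measurable [set x | a <= F x <= b].
Proof.
move=> /is_cdf_measurable mF; rewrite -[X in measurable X]setTI.
exact: (mF measurableT _ (measurable_itv `[a, b])).
Qed.

(* Discretize all coordinates but the first on a grid of mesh 1/m. On each grid
   cell the remaining term is confined to an interval, which the first
   coordinate, being independent of the cell, meets with small probability. *)
Lemma sum_sqr_atomless {k} (X : 'I_k.+1 -> {RV P >-> R}) F (c : 'I_k.+1 -> R) t :
  is_cdf F -> continuous F -> iid_cdf X F -> (forall i, 0 <= c i <= 1) ->
  P [set w | \sum_i (c i - F (X i w)) ^+ 2 = t] = 0%E.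
Proof.
move=> cdfF contF [indX cdfX] c01.
set E := [set w | _]; apply/eqP; rewrite eq_le measure_ge0 andbT.
apply/lee_addgt0Pr => e e0; rewrite add0e.
have mFX i : measurable_fun setT (F \o X i).
  by apply: measurableT_comp => //; exact: is_cdf_measurable.
have mE : measurable E.
  have mS : measurable_fun setT (fun w => \sum_i (c i - F (X i w)) ^+ 2).
    apply: measurable_sum => i; apply: measurable_funX.
    by apply: measurable_funB => //; exact: mFX.
  by have := mS measurableT _ (measurable_set1 t); rewrite setTI.
(* The [m ^ k] boxes have probability at most [4 * h / m ^ k] each, in total [4 * h = e]. The choice
   of [m] keeps the discretization error, at most [2 / m] per coordinate, below [h ^+ 2 / 2]
   overall. *)
pose h := e / 4; have h0 : 0 < h by rewrite divr_gt0.
pose m := (Num.truncn (k%:R * 4 / h ^+ 2)).+1.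
have m0 : 0 < m%:R :> R by rewrite ltr0n.
have hm : k%:R * (2 * m%:R^-1) <= h ^+ 2 / 2.
  have : k%:R * 4 / h ^+ 2 <= m%:R by rewrite ltW// truncnS_gt.
  rewrite ler_pdivrMr ?exprn_gt0// mulrA ler_pdivrMr//; lra.
pose S (f : {ffun 'I_k -> 'I_m}) :=
  \sum_j (c (lift ord0 j) - (f j)%:R / m%:R) ^+ 2.
pose cell (j : 'I_m) := [set x | j%:R / m%:R <= F x <= j.+1%:R / m%:R].
pose near0 f := [set x | `|(c ord0 - F x) ^+ 2 - (t - S f)| <= h ^+ 2 / 2].
pose B (f : {ffun 'I_k -> 'I_m}) (i : 'I_k.+1) :=
  if unlift ord0 i is Some j then cell (f j) else near0 f.
have mB f i : measurable (B f i).
  rewrite /B; case: unliftP => [j|] _; first exact: measurable_cdf_itv.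
  rewrite -[X in measurable X]setTI; apply: measurable_fun_le => //.
  apply: measurableT_comp => //; apply: measurable_funB => //.
  by apply: measurable_funX; apply: measurable_funB => //; exact: is_cdf_measurable.
(* The full index set is written in the form that [mutually_independent] expects. *)
pose A f := \bigcap_(i in [set` [set: 'I_k.+1]%SET]) (X i @^-1` B f i).
have mXB f i : measurable (X i @^-1` B f i) by exact: measurable_funPTI.
have mA f : measurable (A f) by apply: fin_bigcap_measurable.
have PA f : (P (A f) <= (4 * h * m%:R^-1 ^+ k)%:E)%E.
  rewrite (indX _ _ (mB f)); under eq_bigl => i do rewrite inE.
  rewrite big_ord_recl EFinM lee_pmul//.
  - by apply: prode_ge0.
  - by rewrite /B unlift_none; exact: (probability_sqr_near _ cdfF contF _ (cdfX _)).
  - under eq_bigr => j _ do rewrite -[P _]fineK ?fin_num_measure//.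
    rewrite -(big_morph EFin EFinM erefl) lee_fin -[X in _ ^+ X]card_ord -prodr_const.
    apply: ler_prod => j _; rewrite fine_ge0//= -lee_fin fineK ?fin_num_measure//.
    rewrite /B liftK; apply: le_trans (probability_cdf_itv _ cdfF contF _ (cdfX _) _ _ _) _.
      by rewrite ler_pM2r ?invr_gt0// ler_nat.
    by rewrite lee_fin -mulrBl -natrB// subSnn mul1r.
have EA : E `<=` \bigcup_f A f.
  move=> w Ew; have u0 i := is_cdf_ge0 _ (X i w) cdfF.
  have u1 i := is_cdf_le1 _ (X i w) cdfF.
  have /(_ _)/cid-/all_sig[f fP] (j : 'I_k) : exists l : 'I_m, cell l (X (lift ord0 j) w).
    have mu0 : 0 <= m%:R * F (X (lift ord0 j) w) by rewrite mulr_ge0// ltW.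
    have /andP[rl ru] := truncn_itv mu0.
    have [rm|mr] := ltnP (Num.truncn (m%:R * F (X (lift ord0 j) w))) m.
      exists (Ordinal rm); rewrite /cell/= ler_pdivrMr// ler_pdivlMr// [F _ * _]mulrC rl.
      by rewrite ltW.
    (* Here [F] equals 1, which belongs to the last cell because cells are closed. *)
    exists ord_max; rewrite /cell/=.
    have -> : F (X (lift ord0 j) w) = 1.
      apply/eqP; rewrite eq_le u1/= -(ler_pM2l m0) mulr1.
      by apply: le_trans rl; rewrite ler_nat.
    by rewrite ler_pdivrMr// ler_pdivlMr// !mul1r ler_nat leqnSn lexx.
  exists (finfun f) => // i _; rewrite /B /preimage/=; case: unliftP => [j ->|->].
    by rewrite ffunE; exact: fP.
  rewrite /near0/= -Ew big_ord_recl /S.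
  rewrite (_ : _ - _ = \sum_j ((c (lift ord0 j) - (finfun f j)%:R / m%:R) ^+ 2
      - (c (lift ord0 j) - F (X (lift ord0 j) w)) ^+ 2)); last first.
    by rewrite sumrB; ring.
  apply: le_trans (ler_norm_sum _ _ _) (le_trans _ hm).
  apply: (@le_trans _ _ (\sum_(j < k) (2 * m%:R^-1))); last first.
    by rewrite sumr_const card_ord -[_ *+ k]mulr_natl.
  apply: ler_sum => j _.
  have := fP j; rewrite /cell/= ffunE -[(f j).+1%:R]natr1 mulrDl mul1r.
  have /andP[] := c01 (lift ord0 j); move: (u0 (lift ord0 j)) (u1 (lift ord0 j)).
  have : 0 < m%:R^-1 :> R by rewrite invr_gt0.
  have : (f j)%:R / m%:R <= 1 :> R.
    by rewrite ler_pdivrMr// mul1r ler_nat ltnW.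
  have : 0 <= (f j)%:R / m%:R :> R by rewrite divr_ge0// ltW.
  move: (c _) (F _) (m%:R^-1) (_ / _) => b u v a a0 a1 v0 uu0 uu1 b0 b1 /andP[au ua].
  (* The difference of squares factors as [(u - a) * (2 * b - a - u)], with factors bounded by
     [1 / m] and 2, where [a] is the grid point. *)
  by rewrite ler_norml; apply/andP; split; nra.
apply: le_trans (union_bound _ _ _ mE mA EA PA) _.
rewrite card_ffun !card_ord lee_fin natrX mulrCA -exprMn divff ?gt_eqF// expr1n mulr1.
by rewrite /h; lra.
Qed.

End Probability.

(** * Distribution functions at their quantiles *)

Section Quantile.
Context {d : measure_display} {T : measurableType d} {R : realType}.
Variables (P : probability T R) (f : T -> R) (M u : R).
Hypotheses (mf : measurable_fun setT f) (f0M : forall w, 0 <= f w <= M).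
Hypothesis u01 : 0 < u < 1.

Let H t := fine (P [set w | f w <= t]).
Let q := quantile H u.

Let mle t : measurable [set w | f w <= t].
Proof. by rewrite -[X in measurable X]setTI; apply: measurable_fun_le. Qed.

(** With [nonemptyH], this makes [q] a genuine infimum rather than a default value. *)
Let lbH : lbound [set t | u <= H t] 0.
Proof.
move=> t /= uHt; rewrite leNgt; apply/negP => t0; move: uHt.
rewrite /H (_ : [set _ | _] = set0) ?measure0/= ?leNgt; first by case/andP: u01 => ->.
rewrite -subset0 => w /= /le_lt_trans/(_ t0).
by rewrite ltNge; have /andP[->] := f0M w.
Qed.

Let nonemptyH : [set t | u <= H t] !=set0.
Proof.
exists M; rewrite /= /H (_ : [set _ | _] = setT) ?probability_setT/=.
  by case/andP: u01 => _ /ltW.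
by rewrite -subTset => w _ /=; have /andP[] := f0M w.
Qed.

Let homH s t : s <= t -> H s <= H t.
Proof.
move=> st; rewrite fine_le ?fin_num_measure// le_measure ?inE//.
by move=> w /= /le_trans; apply.
Qed.

Lemma quantile_ge0 : 0 <= q.
Proof. exact: lb_le_inf. Qed.

(** Continuity of [P] from above along [q + k.+1%:R^-1], where [H] is at least [u]. *)
Lemma cdf_quantile_ge : u <= H q.
Proof.
pose G k := [set w | f w <= q + k.+1%:R^-1].
have GE : \bigcap_k G k = [set w | f w <= q].
  apply/seteqP; split => w /= => [Gw|fq k _]; last by rewrite /G/= (le_trans fq)// lerDl.
  apply/ler_addgt0Pr => e e0; apply: le_trans (Gw (Num.truncn e^-1) I) _.
  rewrite lerD2l -[leRHS]invrK lef_pV2 ?posrE ?invr_gt0//.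
  by rewrite ltW// truncnS_gt.
have : P \o G @ \oo --> P (\bigcap_k G k).
  apply: nonincreasing_cvg_mu.
  - by rewrite (le_lt_trans (probability_le1 _ _))// ?ltry//; exact: mle.
  - by move=> k; exact: mle.
  - by rewrite GE; exact: mle.
  - move=> i j ij; apply/subsetPset => w /= /le_trans; apply.
    by rewrite lerD2l lef_pV2 ?posrE// ler_nat.
rewrite GE -[P [set w | _]]fineK ?fin_num_measure// => /fine_cvg cvgH.
apply: (cvgr_to_ge cvgH); apply: nearW => k /=.
have [t /= ut tk] : exists2 t, u <= H t & t < q + k.+1%:R^-1.
  by apply: inf_lt => //; rewrite ltrDl invr_gt0.
by rewrite (le_trans ut)// homH// ltW.
Qed.

(** Continuity of [P] from below along [q - k.+1%:R^-1], where [H] is less than [u]; the null set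
    [f w = q] adds nothing. *)
Lemma cdf_quantile_eq : P [set w | f w = q] = 0%E -> H q = u.
Proof.
move=> atomless; apply/eqP; rewrite eq_le cdf_quantile_ge andbT.
pose G k := [set w | f w <= q - k.+1%:R^-1].
have GE : [set w | f w <= q] = (\bigcup_k G k) `|` [set w | f w = q].
  apply/seteqP; split => w /=; last first.
    by case=> [[k _] /le_trans|->//]; apply; rewrite gerBl.
  rewrite le_eqVlt => /orP[/eqP|fq]; [by right|left].
  exists (Num.truncn (q - f w)^-1) => //; rewrite /G/= lerBrDr addrC -lerBrDr.
  rewrite -[leRHS]invrK lef_pV2 ?posrE ?invr_gt0 ?subr_gt0//.
  by rewrite ltW// truncnS_gt.
have mG k : measurable (G k) by exact: mle.
have mU : measurable (\bigcup_k G k) by exact: bigcup_measurable.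
have meq : measurable [set w | f w = q].
  by have := mf measurableT _ (measurable_set1 q); rewrite setTI.
have : P \o G @ \oo --> P (\bigcup_k G k).
  apply: nondecreasing_cvg_mu => // i j ij; apply/subsetPset => w /= /le_trans; apply.
  by rewrite lerD2l lerN2 lef_pV2 ?posrE// ler_nat.
rewrite -[P (\bigcup_k _)]fineK ?fin_num_measure// => /fine_cvg cvgH.
rewrite /H GE measureU0//; apply: (cvgr_to_le cvgH); apply: nearW => k /=.
rewrite leNgt; apply/negP => /ltW /= uk.
have lb : has_lbound [set t | u <= H t] by exists 0.
have := ge_inf lb (uk : [set t | u <= H t] (q - k.+1%:R^-1)).
by rewrite -/(quantile H u) -/q lerBrDl gerDr leNgt invr_gt0 ltr0n.
Qed.

End Quantile.

(** * The statistic with distribution function [Hn] *)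

Section Statistic.
Context {d : measure_display} {T : measurableType d} {R : realType}.
Context {P : probability T R} {n : nat} (X : 'I_n -> {RV P >-> R}) (F : R -> R).
Hypotheses (n0 : (0 < n)%N) (cdfF : is_cdf F).

Let S w := Num.sqrt n%:R * dist_n (sample X w) (ecdf (sample X w)) F.

Let SE w : S w = Num.sqrt (\sum_(i < n) (ecdf (sample X w) (X i w) - F (X i w)) ^+ 2).
Proof.
by rewrite /S /dist_n -sqrtrM ?ler0n// mulVKf// pnatr_eq0 -lt0n.
Qed.

Lemma measurable_statistic : measurable_fun setT S.
Proof.
rewrite (_ : S = Num.sqrt \o (fun w => \sum_(i < n)
    (ecdf (sample X w) (X i w) - F (X i w)) ^+ 2)); last exact/funext/SE.
apply: measurableT_comp.
  by apply: continuous_measurable_fun; exact: sqrt_continuous.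
apply: measurable_sum => i; apply: measurable_funX; apply: measurable_funB.
  exact: (measurable_ecdf (fun i w => X i w)).
by apply: measurableT_comp => //; exact: is_cdf_measurable.
Qed.

Lemma statistic_itv w : 0 <= S w <= Num.sqrt n%:R.
Proof.
rewrite SE sqrtr_ge0 ler_sqrt ?ler0n//= -[X in X%:R]card_ord -sumr_const.
apply: ler_sum => i _; rewrite -real_normK ?num_real// expr_le1//.
exact: (cdf_dist_le1 _ _ _ (ecdf_is_cdf _ _ n0)).
Qed.

(** At the sample points the empirical CDF takes only finitely many vectors of values. For each of
    them the centres are constants and [sum_sqr_atomless] applies. *)
Lemma statistic_atomless t : continuous F -> iid_cdf X F -> P [set w | S w = t] = 0%E.
Proof.
case: n X n0 @S SE measurable_statistic => // k Y _ S' S'E mS' contF iidY.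
(* Counts among [k.+1] points range from 0 to [k.+1], hence ['I_k.+2]. *)
pose A (r : {ffun 'I_k.+1 -> 'I_k.+2}) :=
  [set w | \sum_i ((r i)%:R / k.+1%:R - F (Y i w)) ^+ 2 = t ^+ 2].
have mA r : measurable (A r).
  have mS : measurable_fun setT (fun w => \sum_i ((r i)%:R / k.+1%:R - F (Y i w)) ^+ 2).
    apply: measurable_sum => i; apply: measurable_funX; apply: measurable_funB => //.
    by apply: measurableT_comp => //; exact: is_cdf_measurable.
  by have := mS measurableT _ (measurable_set1 (t ^+ 2)); rewrite setTI.
have mE : measurable [set w | S' w = t].
  by have := mS' measurableT _ (measurable_set1 t); rewrite setTI.
have := union_bound P A _ 0 mE mA; rewrite mulr0 measure_le0 => bound.
apply/eqP; apply: bound => [w /= Sw|r].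
  have cnt i : (\sum_(j < k.+1) (Y j w <= Y i w)%R < k.+2)%N.
    rewrite ltnS -[leqRHS]card_ord -sum1_card; apply: leq_sum => j _; exact: leq_b1.
  exists [ffun i => Ordinal (cnt i)] => //; rewrite /A/= -Sw S'E sqr_sqrtr.
    by apply: eq_bigr => i _; rewrite ffunE /= natr_sum mulrC.
  by apply: sumr_ge0 => i _; exact: sqr_ge0.
rewrite (sum_sqr_atomless _ Y F)// => i.
by rewrite divr_ge0//= ler_pdivrMr// mul1r ler_nat -ltnS.
Qed.

End Statistic.

(** If [Hn] jumps across the level [1 - beta], the probability of [alphaL = 0] is the value reached
    by [Hn], which exceeds [1 - beta]; hence exactness at [1 - beta] is stated for continuous
    [F]. *)
Theorem theorem5 (R : realType) (d : measure_display) (T : measurableType d)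
    (P : probability T R) (alpha beta : R) (Fs Fb F : R -> R)
    (n : nat) (X : 'I_n -> {RV P >-> R}) (Fcheck : T -> R -> R -> R)
    (halpha : 0 <= alpha <= 1) (hbeta : 0 < beta < 1)
    (hFs : is_cdf Fs) (hFb : is_cdf Fb) (hFsb : Fs <> Fb)
    (hF : F = mixture alpha Fs Fb)
    (hn : (0 < n)%N) (hX : iid_cdf X F)
    (hFcheck : forall (w : T) (gamma : R), 0 < gamma <= 1 ->
       is_closest_cdf (sample X w) (unmix (ecdf (sample X w)) Fb gamma)
         (Fcheck w gamma)) :
  ((1 - beta)%:E <=
     P [set w | (alphaL (sample X w) Fb (Fcheck w)
                   (quantile (Hn X F) (1 - beta)) <= alpha0 F Fb)%R])%E
  /\
  (alpha0 F Fb = 0 ->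
     P [set w | alphaL (sample X w) Fb (Fcheck w)
                  (quantile (Hn X F) (1 - beta)) = 0]
       = (Hn X F (quantile (Hn X F) (1 - beta)))%:E
     /\
     (continuous F ->
        P [set w | alphaL (sample X w) Fb (Fcheck w)
                     (quantile (Hn X F) (1 - beta)) = 0]
          = (1 - beta)%:E)).
Proof.
have cdfF : is_cdf F by rewrite hF; exact: mixture_is_cdf.
have u01 : 0 < 1 - beta < 1.
  by case/andP: hbeta => b0 b1; rewrite subr_gt0 b1 gtrBl.
have mS := measurable_statistic X F hn cdfF.
have S0M := statistic_itv X F hn cdfF.
have q0 := quantile_ge0 P _ _ _ S0M u01.
have qge := cdf_quantile_ge P _ _ _ mS S0M u01.
have qeq := cdf_quantile_eq P _ _ _ mS S0M u01.
rewrite -/(Hn X F) in q0 qge qeq.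
set q := quantile _ _ in q0 qge qeq *.
have n0 : 0 < Num.sqrt n%:R :> R by rewrite sqrtr_gt0 ltr0n.
have c0 : 0 <= q / Num.sqrt n%:R by rewrite divr_ge0// ltW.
have distE w : (dist_n (sample X w) (ecdf (sample X w)) F <= q / Num.sqrt n%:R) =
    (Num.sqrt n%:R * dist_n (sample X w) (ecdf (sample X w)) F <= q).
  by rewrite ler_pdivlMr// mulrC.
have mle : measurable [set w |
    Num.sqrt n%:R * dist_n (sample X w) (ecdf (sample X w)) F <= q].
  by rewrite -[X in measurable X]setTI; apply: measurable_fun_le.
have PS : P [set w | Num.sqrt n%:R * dist_n (sample X w) (ecdf (sample X w)) F <= q]
    = (Hn X F q)%:E by rewrite /Hn fineK// fin_num_measure.
under [X in P X]eq_set => w do rewrite (alphaLE _ _ _ _ q erefl).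
split.
  rewrite (@le_trans _ _ (Hn X F q)%:E) ?lee_fin// -PS le_measure ?inE//.
    apply: (measurable_inf_admissible (fun i w => X i w)) => //.
    exact: alpha0_ge0.
  move=> w /=; rewrite -distE; apply: inf_admissible_le_alpha0 => //; exact: hFcheck.
move=> a0; have FE := alpha0_eq0 _ _ cdfF hFb a0.
under [X in P X]eq_set => w do rewrite (alphaLE _ _ _ _ q erefl).
have A0 w : inf (admissible (sample X w) Fb (Fcheck w) (q / Num.sqrt n%:R)) = 0 <->
    dist_n (sample X w) (ecdf (sample X w)) F <= q / Num.sqrt n%:R.
  rewrite FE; apply: inf_admissible_eq0 => //; exact: hFcheck.
have -> : P [set w | inf (admissible (sample X w) Fb (Fcheck w) (q / Num.sqrt n%:R)) = 0]
    = (Hn X F q)%:E.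
  rewrite -PS; congr (P _); apply/seteqP; split => w /=.
    by move=> /A0; rewrite -distE.
  by move=> Sq; apply/A0; rewrite distE.
split => // contF; congr EFin; apply: qeq.
exact: statistic_atomless.
Qed.
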